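(* Let $n\ge 1$, let $T$ be the $n\times n$ matrix with entries $T_{ij}=1+\operatorname{sgn}(i-j)$ (so $T_{ij}=0$ for $i<j$, $T_{ii}=1$, $T_{ij}=2$ for $i>j$), let $X$ be an arbitrary symmetric $n\times n$ matrix, let $1\le k\le n$, and let $$S=\sum_{\substack{I,J\in\binom{[n]}{k}\\ I\le J}} 2^{p(I,J)}\,|X_{IJ}|.$$ Then: (a) the sum of the principal $k\times k$ minors of $TX$ equals $S$; (b) the sum of all $k\times k$ minors of $X$ equals $S$.
   Context: $[n]=\{1,\dots,n\}$ and $\binom{[n]}{k}$ is the set of $k$-element subsets of $[n]$. For $I=\{i_1<\dots<i_k\}$, $J=\{j_1<\dots<j_k\}$ in $\binom{[n]}{k}$, $|X_{IJ}|=\det(x_{i_r j_s})_{r,s=1}^k$ is the minor with row indices $I$ and column indices $J$; it is principal if $I=J$. The notation $I\le J$ (interlacing) means $i_1\le j_1\le i_2\le j_2\le\dots\le i_k\le j_k$. Further $p(I,J)=k-\operatorname{card}(I\cap J)$. *)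

(* Defs.v *)
From HB Require Import structures.
From mathcomp Require Import all_boot all_order all_algebra.

Set Implicit Arguments.
Unset Strict Implicit.
Unset Printing Implicit Defensive.

Import Order.TTheory GRing.Theory Num.Theory.
Local Open Scope ring_scope.

(* The index set [n] = {1, ..., n} is encoded as 'I_n = {0, ..., n-1}. Every
   notion below depends only on the order and the differences of indices, so
   the shift by one is immaterial. *)
Notation ksubset n k := {I : {set 'I_n} | #|I| == k}.

(* [elt I r] is i_(r+1), where I = {i_1 < ... < i_k}: [enum_val] lists a subset
   of 'I_n in increasing order, see [elt_lt] below. *)
Definition elt (n k : nat) (I : ksubset n k) (r : 'I_k) : 'I_n :=
  enum_val (cast_ord (esym (eqP (valP I))) r).

Lemma elt_lt (n k : nat) (I : ksubset n k) (r s : 'I_k) :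
  (r < s)%N -> (elt I r < elt I s)%N.
Proof.
move=> rs; have x0 := elt I r.
have sz : size (enum (val I)) = k by rewrite -cardE (eqP (valP I)).
have srt : sorted (relpre (@nat_of_ord n) ltn) (enum (val I)).
  have tr : transitive (relpre (@nat_of_ord n) ltn).
    by move=> y x z; apply: ltn_trans.
  rewrite /enum_mem; apply: (sorted_filter tr).
  by rewrite -enumT -sorted_map val_enum_ord iota_ltn_sorted.
rewrite /elt !(enum_val_nth x0) /=.
apply: (sorted_ltn_nth _ x0 srt) => //.
- by move=> y x z; apply: ltn_trans.
- by rewrite inE sz.
- by rewrite inE sz.
Qed.

Lemma mem_elt (n k : nat) (I : ksubset n k) (r : 'I_k) : elt I r \in val I.
Proof. exact: enum_valP. Qed.

Definition minor (R : comNzRingType) (n k : nat) (A : 'M[R]_n)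
    (I J : ksubset n k) : R :=
  \det (mxsub (elt I) (elt J) A).

Definition interlacing (n k : nat) (I J : ksubset n k) : bool :=
  [forall r : 'I_k, (elt I r <= elt J r)%N] &&
  [forall r : 'I_k, forall s : 'I_k,
     (s == r.+1 :> nat) ==> (elt J r <= elt I s)%N].

Definition pdist (n k : nat) (I J : ksubset n k) : nat :=
  (k - #|val I :&: val J|)%N.

Definition Tmx (R : comNzRingType) (n : nat) : 'M[R]_n :=
  \matrix_(i, j) (1 + Num.sg ((i : nat)%:Z - (j : nat)%:Z))%:~R.

Definition interlacing_sum (R : comNzRingType) (n k : nat) (X : 'M[R]_n) : R :=
  \sum_(I : ksubset n k) \sum_(J : ksubset n k | interlacing I J)
    2 ^+ pdist I J * minor X I J.

(* Main.v *)
Require Import Defs.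
From mathcomp Require Import all_boot all_order all_algebra.
From mathcomp Require Import ring zify.

(** (a) By Cauchy-Binet the sum of the principal minors of [TX] is the sum over
    [I, J] of [|T_IJ| |X_JI|], and [|T_IJ|] is [2 ^ p(I, J)] if [J <= I] and [0]
    otherwise.

    (b) A symmetric [X] is [V D V^T] with [D] diagonal and the columns of the
    integer matrix [V] of the form [e_i] or [e_i + e_j]. By Cauchy-Binet, both
    the sum of all minors of [X] and that of the principal minors of [TX] become
    sums over [L] of [D_L] times, respectively, [(\sum_I |V_IL|)^2] and
    [|V_L^T T V_L|]. So it suffices to show [|Y^T T Y| = (\sum_I |Y_I|)^2] for an
    [n x k] rational matrix [Y]. Write [T = E + A] with [E] all ones and [A] the
    skew matrix of signs. For [k] even, [|Y^T T Y| = |Y^T A Y|], and for [k] odd it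
    is the determinant of [Y^T A Y] bordered by the column sums of [Y]. On the
    other side, [\sum_I |Y_I|] satisfies the expansion of a Pfaffian along a row;
    column operations then clear that row but for one entry, which reduces [k]
    by two.

    The expansions are carried out in the exterior algebra, whose elements are
    represented by their coordinates [u : {set 'I_n} -> R]. *)

Set Implicit Arguments.
Unset Strict Implicit.
Unset Printing Implicit Defensive.

Import Order.TTheory GRing.Theory Num.Theory.
Local Open Scope ring_scope.

(** * Creation and annihilation operators on the exterior algebra *)

(** The arguments are integers, not ordinals, so that [t = -1], below every index, is allowed. *)
Definition sgd (R : comNzRingType) (x t : int) : R := (Num.sg (x - t))%:~R.

Section Fock.

Variables (R : comNzRingType) (n : nat).
Implicit Types (i l : 'I_n) (J K : {set 'I_n}) (u : {set 'I_n} -> R).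
Implicit Types (a z : 'I_n -> R).

Lemma sgdxx (x : int) : sgd R x x = 0.
Proof. by rewrite /sgd subrr sgr0. Qed.

Lemma sgd_gt (x t : int) : t < x -> sgd R x t = 1.
Proof. by move=> h; rewrite /sgd gtr0_sg ?subr_gt0. Qed.

Lemma sgd_lt (x t : int) : x < t -> sgd R x t = -1.
Proof. by move=> h; rewrite /sgd ltr0_sg ?subr_lt0. Qed.

Lemma sgd_skew (x t : int) : sgd R t x = - sgd R x t.
Proof. by rewrite /sgd -opprB sgrN rmorphN. Qed.

Lemma sgd_sqr (x t : int) : x != t -> sgd R x t * sgd R x t = 1.
Proof. by case: ltgtP => // h _; rewrite ?(sgd_gt h) ?(sgd_lt h); ring. Qed.

(* For [i \notin K] this is the sign [(-1) ^ #{x in K | x < i}] of inserting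
   [i] in the increasing list of [K]; it vanishes for [i \in K]. *)
Definition isgn i K : R := \prod_(x in K) sgd R x i.

Lemma isgnD1 i l K : l \in K -> isgn i K = sgd R l i * isgn i (K :\ l).
Proof. by move=> h; rewrite /isgn (big_setD1 l). Qed.

Lemma isgn_in i K : i \in K -> isgn i K = 0.
Proof. by move=> h; rewrite (isgnD1 _ h) sgdxx mul0r. Qed.

Lemma isgn_sqr i K : i \notin K -> isgn i K * isgn i K = 1.
Proof.
move=> h; rewrite /isgn -big_split big1 //= => x xK; apply: sgd_sqr.
by apply: contraNneq h => /eqP; rewrite eqz_nat => /eqP/ord_inj <-.
Qed.

(** Left exterior multiplication by the vector [z]. *)
Definition wedge z u J : R := \sum_(i in J) z i * isgn i (J :\ i) * u (J :\ i).

(** Interior product with the linear form [a]; terms with [i \in K] vanish because [isgn i K]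
    does. *)
Definition contract a u K : R := \sum_i a i * isgn i K * u (i |: K).

Lemma eq_wedge z u v : u =1 v -> wedge z u =1 wedge z v.
Proof. by move=> uv J; apply: eq_bigr => i _; rewrite uv. Qed.

(* The canonical anticommutation relation between creation and annihilation
   operators. *)
Lemma contract_wedge a z u K :
  contract a (wedge z u) K = (\sum_i a i * z i) * u K - wedge z (contract a u) K.
Proof.
apply/eqP; rewrite eq_sym subr_eq eq_sym; apply/eqP.
have -> : wedge z (contract a u) K =
  \sum_i \sum_(l in K)
     z l * isgn l (K :\ l) * (a i * isgn i (K :\ l) * u (i |: (K :\ l))).
  by rewrite exchange_big; apply: eq_bigr => l lK; rewrite mulr_sumr.
rewrite -big_split mulr_suml; apply: eq_bigr => i _ /=.
have [iK|iK] := boolP (i \in K).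
  rewrite isgn_in // mulr0 mul0r add0r (big_setD1 i) //= big1 ?addr0.
    rewrite setD1K // -[RHS]mulr1 -(@isgn_sqr i (K :\ i)) ?setD11 //; ring.
  move=> l /setD1P[li lK]; rewrite (@isgn_in i) ?inE 1?eq_sym ?li //; ring.
(* For [i \notin K], the new element [i] gives the right-hand side; every other [l] cancels, since
   exchanging [i] and [l] flips the sign. *)
rewrite /wedge big_setU1 //= setU1K // mulrDr mulr_sumr -addrA -big_split /=.
rewrite big1 ?addr0; first by rewrite -[RHS]mulr1 -(isgn_sqr iK); ring.
move=> l lK.
have li : i != l by apply: contraNneq iK => ->.
have -> : (i |: K) :\ l = i |: (K :\ l).
  by apply/setP => x; rewrite !inE; case: (x =P i) => [->|] //=; rewrite li.
have -> : isgn l (i |: (K :\ l)) = sgd R i l * isgn l (K :\ l).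
  by rewrite /isgn big_setU1 //= !inE (negPf iK) andbF.
rewrite (isgnD1 i lK) (sgd_skew l i).
have : sgd R l i * sgd R l i = 1 by rewrite sgd_sqr // eqz_nat eq_sym.
set s := sgd R l i => s2.
transitivity ((1 - s * s) * (z l * isgn l (K :\ l) *
                (a i * isgn i (K :\ l) * u (i |: (K :\ l))))); first by ring.
by rewrite s2; ring.
Qed.

(** Coordinates of the exterior product of the columns of [Y], column 0 leftmost, starting from the
    vacuum. *)
Fixpoint fock m : 'M[R]_(n, m) -> {set 'I_n} -> R :=
  match m with
  | 0 => fun _ J => (J == set0)%:R
  | m'.+1 => fun Y => wedge (Y^~ 0) (fock (col' 0 Y))
  end.

(** Anticommutation moves the form past the columns, with a sign for each one passed, until it
    annihilates the vacuum. *)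
Lemma contract_fock a m (Y : 'M[R]_(n, m)) K :
  contract a (fock Y) K =
  \sum_(j < m) (-1) ^+ j * (\sum_i a i * Y i j) * fock (col' j Y) K.
Proof.
elim: m Y K => [|m IHm] Y K.
  rewrite big_ord0 /contract big1 // => i _ /=.
  rewrite -cards_eq0 cardsU1.
  by case: (i \in K) (@isgn_in i K) => //= [->|]; rewrite ?mulr0 ?mul0r.
rewrite [fock Y]/= contract_wedge big_ord_recl expr0 mul1r; congr (_ + _).
rewrite (eq_wedge _ (IHm _)) /wedge -sumrN.
under eq_bigr => i _ do rewrite mulr_sumr -sumrN.
rewrite exchange_big; apply: eq_bigr => j _.
case: m Y IHm j => [|m] Y IHm j; first by case: j.
rewrite [fock (col' (lift _ _) Y)]/= /wedge [RHS]mulr_sumr; apply: eq_bigr => i _.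
have -> : col' 0 (col' (lift ord0 j) Y) = col' j (col' 0 Y).
  apply/matrixP => x y; rewrite !mxE; congr (Y _ _); apply: val_inj => /=.
  by rewrite /bump /= !add1n; lia.
have -> : \sum_i0 a i0 * col' 0 Y i0 j = \sum_i0 a i0 * Y i0 (lift ord0 j).
  by apply: eq_bigr => x _; rewrite !mxE.
have -> : col' (lift ord0 j) Y i 0 = Y i 0.
  by rewrite !mxE; congr (Y _ _); apply: val_inj.
by rewrite /= /bump leq0n add1n exprS; ring.
Qed.

Lemma fock_card m (Y : 'M[R]_(n, m)) J : #|J| != m -> fock Y J = 0.
Proof.
elim: m Y J => [|m IHm] Y J /=; first by rewrite cards_eq0 => /negPf->.
move=> h; rewrite /wedge big1 // => i iJ; rewrite IHm ?mulr0 //.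
by apply: contraNneq h; rewrite (cardsD1 i J) iJ => ->.
Qed.

(* [wedge z] is adjoint to [contract z]. *)
Lemma sum_wedge z u v :
  \sum_J v J * wedge z u J = \sum_K contract z v K * u K.
Proof.
under eq_bigr => J _ do rewrite /wedge mulr_sumr.
under [RHS]eq_bigr => K _ do rewrite /contract mulr_suml.
rewrite exchange_big [LHS](exchange_big_dep xpredT) //=.
apply: eq_bigr => i _.
rewrite [RHS](bigID (fun K => i \notin K)) /= [X in _ = _ + X]big1 ?addr0; last first.
  by move=> K /negbNE iK; rewrite isgn_in // mulr0 !mul0r.
rewrite (reindex_onto (fun K => i |: K) (fun J => J :\ i)) /=; last first.
  by move=> J iJ; rewrite setD1K.
apply: eq_big => K.
  by rewrite setU11 /=; apply/eqP/idP=> [<-|/setU1K//]; rewrite setD11.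
by rewrite setU11 => /eqP eK; rewrite eK; ring.
Qed.

End Fock.

(** * Cauchy-Binet formula *)

Lemma big_elt (S : Type) (idx : S) (op : Monoid.com_law idx) (n k : nat)
    (I : ksubset n k) (F : 'I_n -> S) :
  \big[op/idx]_(i in val I) F i = \big[op/idx]_(r < k) F (elt I r).
Proof.
rewrite big_enum_val (reindex (cast_ord (esym (eqP (valP I))))) //=.
by exists (cast_ord (eqP (valP I))) => r _; rewrite ?cast_ordK ?cast_ordKV.
Qed.

Lemma elt_inj (n k : nat) (I : ksubset n k) : injective (elt I).
Proof. by move=> r s /enum_val_inj/cast_ord_inj. Qed.

Lemma elt_surj (n k : nat) (I : ksubset n k) i : i \in val I -> exists r, i = elt I r.
Proof.
move=> iI; exists (cast_ord (eqP (valP I)) (enum_rank_in iI i)).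
by rewrite /elt cast_ordK enum_rankK_in.
Qed.

(** The [k] distinct values of [f] exhaust [I], and a strictly sorted list is determined by its
    elements. *)
Lemma elt_uniq (n k : nat) (I : ksubset n k) (f : 'I_k -> 'I_n) :
    {homo f : r s / (r < s)%N} -> (forall r, f r \in val I) -> f =1 elt I.
Proof.
move=> f_homo fI.
pose ltI (m : nat) := relpre (@nat_of_ord m) ltn.
have ltI_tr m : transitive (ltI m) by move=> y x z; apply: ltn_trans.
have ltI_irr m : irreflexive (ltI m) by move=> x; rewrite /ltI /= ltnn.
have enum_sorted m : sorted (ltI m) (enum 'I_m).
  by rewrite -sorted_map val_enum_ord iota_ltn_sorted.
have sI : sorted (ltI n) (enum (val I)).
  by rewrite /enum_mem; apply: sorted_filter; rewrite // -enumT.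
have sf : sorted (ltI n) (codom f).
  by apply: homo_sorted (enum_sorted k) => x y; apply: f_homo.
have uf : uniq (codom f) by exact: (sorted_uniq (ltI_tr n) (ltI_irr n) sf).
have codomE : codom f = enum (val I).
  apply: (irr_sorted_eq (ltI_tr n) (ltI_irr n) sf sI).
  have sub : {subset codom f <= enum (val I)}.
    by move=> _ /codomP[r ->]; rewrite mem_enum.
  have [//|_ ] := uniq_min_size uf sub.
    by rewrite size_codom card_ord -cardE (eqP (valP I)).
  by [].
move=> r; rewrite /elt (enum_val_nth (f r)) /= -codomE.
by rewrite /codom /image_mem (nth_map r) ?size_enum_ord // nth_ord_enum.
Qed.

Lemma ksubset_rem_proof (n k : nat) (I : ksubset n k.+1) (r : 'I_k.+1) :
  #|val I :\ elt I r| == k.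
Proof.
by have := eqP (valP I); rewrite (cardsD1 (elt I r)) mem_elt add1n => -[->].
Qed.

Definition ksubset_rem (n k : nat) (I : ksubset n k.+1) (r : 'I_k.+1) : ksubset n k :=
  Sub (val I :\ elt I r) (ksubset_rem_proof I r).

Lemma elt_rem (n k : nat) (I : ksubset n k.+1) (r : 'I_k.+1) s :
  elt I (lift r s) = elt (ksubset_rem I r) s.
Proof.
apply: (elt_uniq (f := fun s => elt I (lift r s))) => [s1 s2 s12|s'].
  by apply: elt_lt; move: s12; rewrite /= /bump; lia.
by rewrite !inE mem_elt (inj_eq (@elt_inj _ _ I)) eq_sym neq_lift.
Qed.

Section Minors.

Variable R : comNzRingType.

(** Exactly [r] elements lie below [elt I r], each contributing [-1]. *)
Lemma isgn_elt (n k : nat) (I : ksubset n k.+1) (r : 'I_k.+1) :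
  isgn R (elt I r) (val I :\ elt I r) = (-1) ^+ r.
Proof.
rewrite /isgn (big_elt _ (ksubset_rem I r)) /=.
transitivity (\prod_(s < k) (if (s < r)%N then -1 else 1 : R)).
  apply: eq_bigr => s _; rewrite -elt_rem; case: ltnP => sr.
    by apply: sgd_lt; rewrite ltz_nat elt_lt //= /bump; lia.
  by apply: sgd_gt; rewrite ltz_nat elt_lt //= /bump; lia.
have rk : (r <= k)%N by rewrite -ltnS.
by rewrite -big_mkcond (big_ord_narrow rk) prodr_const card_ord.
Qed.

(** The recursion of [fock] is the Laplace expansion along column 0. *)
Lemma fock_minor (n k : nat) (Y : 'M[R]_(n, k)) (I : ksubset n k) :
  fock Y (val I) = \det (rowsub (elt I) Y).
Proof.
elim: k Y I => [|k IHk] Y I.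
  by rewrite det_mx00 /= -cards_eq0 (eqP (valP I)).
rewrite /= /wedge big_elt (expand_det_col _ 0); apply: eq_bigr => r _.
rewrite isgn_elt mxE /cofactor addn0 -mulrA; congr (_ * (_ * _)).
rewrite -[_ :\ _]/(val (ksubset_rem I r)) IHk; congr (\det _).
by apply/matrixP => s t; rewrite !mxE -elt_rem.
Qed.

Lemma sum_ksubset (n k : nat) (F : {set 'I_n} -> R) :
    (forall J : {set 'I_n}, #|J| != k -> F J = 0) ->
  \sum_J F J = \sum_(I : ksubset n k) F (val I).
Proof.
move=> F0; rewrite (bigID (fun J : {set 'I_n} => #|J| == k)) /=.
rewrite [X in _ + X]big1 ?addr0 //.
exact: (big_sub (fun J : {set 'I_n} => #|J| == k)).
Qed.

(** By adjointness, creation by column 0 of [B] becomes a contraction of [fock A^T], whose expansion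
    is the Laplace expansion of [A *m B] along column 0. *)
Lemma det_mulmx_fock (n k : nat) (A : 'M[R]_(k, n)) (B : 'M[R]_(n, k)) :
  \det (A *m B) = \sum_J fock A^T J * fock B J.
Proof.
elim: k A B => [|k IHk] A B.
  rewrite det_mx00 (bigD1 set0) //= eqxx mulr1 big1 ?addr0 // => J /negPf->.
  by rewrite mul0r.
rewrite [fock B]/= sum_wedge (expand_det_col _ 0).
under [RHS]eq_bigr => K _ do rewrite contract_fock mulr_suml.
rewrite exchange_big; apply: eq_bigr => j _ /=.
under [RHS]eq_bigr => K _ do rewrite -(mulrA (_ * _)).
rewrite -mulr_sumr -(trmxK (col' j _)) -IHk tr_col' trmxK.
rewrite /cofactor addn0 mulrA [_ * (-1) ^+ _]mulrC.
have -> : row' j (col' 0 (A *m B)) = row' j A *m col' 0 B.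
  by apply/matrixP => s t; rewrite !mxE; apply: eq_bigr => i _; rewrite !mxE.
by rewrite mxE; congr (_ * _ * _); apply: eq_bigr => i _; rewrite mxE mulrC.
Qed.

Lemma Cauchy_Binet (n k : nat) (A : 'M[R]_(k, n)) (B : 'M[R]_(n, k)) :
  \det (A *m B) =
  \sum_(I : ksubset n k) \det (colsub (elt I) A) * \det (rowsub (elt I) B).
Proof.
rewrite det_mulmx_fock (sum_ksubset (k := k)) => [|J hJ]; last first.
  by rewrite fock_card ?mul0r.
by apply: eq_bigr => I _; rewrite !fock_minor -[in RHS]det_tr trmx_mxsub.
Qed.

End Minors.

(** * Sums of maximal minors as Pfaffians *)

Section SignSums.

Variables (R : comNzRingType) (n : nat).
Implicit Types (K J : {set 'I_n}).

(** Induction removing the largest element [M], which contributes a factor [1] to the signs of the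
    others. *)
Lemma sum_sgd_isgn (t : int) K :
  \sum_(i in K) sgd R i t * isgn R i (K :\ i) =
  \prod_(x in K) sgd R x t - (~~ odd #|K|)%:R.
Proof.
elim: {K}#|K| {-2}K (erefl #|K|) => [|m IHm] K cK.
  by rewrite cK (cards0_eq cK) !big_set0 subrr.
have /card_gt0P[x0 x0K] : (0 < #|K|)%N by rewrite cK.
pose M := [arg max_(i > x0 in K) nat_of_ord i].
have [MK ltM] : M \in K /\ forall x, x \in K :\ M -> (x < M)%N.
  rewrite /M; case: arg_maxnP => // M' M'K maxM; split=> // x /setD1P[xM xK].
  by rewrite ltn_neqAle xM; apply: maxM.
have cK' : #|K :\ M| = m by move: cK; rewrite (cardsD1 M) MK => -[].
have sgn_below s : (forall x, x \in K :\ M -> (x : nat)%:Z < s) ->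
    \prod_(x in K :\ M) sgd R x s = (-1) ^+ m.
  by move=> lts; rewrite -cK' -prodr_const; apply: eq_bigr => x /lts; apply: sgd_lt.
rewrite (big_setD1 M) // [in RHS](big_setD1 M) //=.
have -> : \sum_(i in K :\ M) sgd R i t * isgn R i (K :\ i) =
          \sum_(i in K :\ M) sgd R i t * isgn R i ((K :\ M) :\ i).
  apply: eq_bigr => i iK; have [iM _] := setD1P iK.
  rewrite (@isgnD1 R n i M) ?inE 1?eq_sym ?iM // (@sgd_gt R M i) ?ltz_nat ?ltM // mul1r.
  by congr (_ * isgn _ _ _); apply/setP=> x; rewrite !inE andbCA.
rewrite IHm // {1}/isgn sgn_below => [|x xK]; last by rewrite ltz_nat ltM.
rewrite cK' cK /= negbK -signr_odd.
have [tM|Mt] := ltP t M; first by rewrite sgd_gt //; case: (odd m) => /=; ring.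
(* If [M <= t], the product over [K :\ M] is also [(-1) ^+ m], so the terms in [sgd R M t] cancel,
   even for [M = t]. *)
rewrite sgn_below => [|x xK]; last by apply: lt_le_trans Mt; rewrite ltz_nat ltM.
by rewrite -(signr_odd R m); case: (odd m) => /=; ring.
Qed.

(** The sum is a pairing with the constant function [1]. Adjointness leads to [sum_sgd_isgn], whose
    correction term is zero on odd sets. *)
Lemma sum_contract_sgd (t : int) (u : {set 'I_n} -> R) :
    (forall J, ~~ odd #|J| -> u J = 0) ->
  \sum_K contract (fun i : 'I_n => sgd R i t) u K =
  \sum_J u J * \prod_(x in J) sgd R x t.
Proof.
move=> u0; under eq_bigr => K _ do rewrite -[contract _ _ _]mulr1.
rewrite -(sum_wedge _ (fun=> 1)); apply: eq_bigr => J _.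
have [oJ|/u0->] := boolP (odd #|J|); last by rewrite !mul0r.
congr (_ * _); rewrite /wedge; under [LHS]eq_bigr => i _ do rewrite mulr1.
by rewrite sum_sgd_isgn oJ subr0.
Qed.

Lemma sum_fock_odd m (Y : 'M[R]_(n, m)) : odd m ->
  \sum_J fock Y J = \sum_K contract (fun=> 1) (fock Y) K.
Proof.
move=> om.
(* At [t = -1] the sign form is the constant form [1]. *)
have c1 K : contract (fun=> 1) (fock Y) K =
            contract (fun i : 'I_n => sgd R i (-1)) (fock Y) K.
  by apply: eq_bigr => i _; rewrite (sgd_gt R (x := i)).
rewrite (eq_bigr _ (fun K _ => c1 K)) sum_contract_sgd => [|J eJ]; last first.
  by apply: fock_card; apply: contraNneq eJ => ->.
by apply: eq_bigr => J _; rewrite big1 ?mulr1 // => x _; rewrite sgd_gt.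
Qed.

(* With [contract_fock], this is the expansion of a Pfaffian along its first row. *)
Lemma sum_fock_even m (Y : 'M[R]_(n, m.+1)) : odd m ->
  \sum_J fock Y J =
  \sum_K contract (fun x : 'I_n => \sum_(i < n) Y i 0 * sgd R x i) (fock (col' 0 Y)) K.
Proof.
move=> om; rewrite [fock Y]/=; set u := fock _.
have u0 J : ~~ odd #|J| -> u J = 0.
  by move=> eJ; apply: fock_card; apply: contraNneq eJ => ->.
under eq_bigr => J _ do rewrite -[wedge _ _ _]mul1r.
rewrite (sum_wedge _ _ (fun=> 1)).
transitivity (\sum_(i < n) Y i 0 * \sum_J u J * isgn R i J).
  under eq_bigr => J _ do rewrite /contract mulr_suml.
  rewrite exchange_big; apply: eq_bigr => i _; rewrite mulr_sumr.
  by apply: eq_bigr => J _; ring.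
(* [isgn R i J] is the product of signs in [sum_contract_sgd] at [t = i]. *)
under eq_bigr => i _ do rewrite -sum_contract_sgd // mulr_sumr.
rewrite exchange_big; apply: eq_bigr => K _; rewrite /contract.
under eq_bigr => i _ do rewrite mulr_sumr.
rewrite exchange_big; apply: eq_bigr => x _; rewrite !mulr_suml.
by apply: eq_bigr => i _; ring.
Qed.

End SignSums.

(** * Skew forms and bordered determinants *)

Definition Amx (R : comNzRingType) n : 'M[R]_n := \matrix_(i, j) sgd R i j.

Definition sumdet (R : comNzRingType) (n k : nat) (Y : 'M[R]_(n, k)) : R :=
  \sum_(I : ksubset n k) \det (rowsub (elt I) Y).

Lemma sumdet_fock (R : comNzRingType) (n k : nat) (Y : 'M[R]_(n, k)) :
  sumdet Y = \sum_J fock Y J.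
Proof.
rewrite (sum_ksubset (k := k)) => [|J]; last exact: fock_card.
by apply: eq_bigr => I _; rewrite fock_minor.
Qed.

Lemma fock_mulmx (R : comNzRingType) (n k : nat) (Y : 'M[R]_(n, k)) (C : 'M[R]_k) J :
  fock (Y *m C) J = \det C * fock Y J.
Proof.
have [cJ|cJ] := boolP (#|J| == k); last by rewrite !fock_card ?mulr0.
rewrite -[J]/(val (exist (fun J : {set 'I_n} => #|J| == k) J cJ)) !fock_minor.
by rewrite -mul_rowsub_mx det_mulmx mulrC.
Qed.

(** The signs make this skew when [c = 0] and [B] is skew; for [c = 1] the Schur complement of the
    corner is [B + b^T *m b]. *)
Definition bordered (R : comNzRingType) k (c : R) (b : 'rV[R]_k) (B : 'M[R]_k) :
  'M[R]_(1 + k) := block_mx c%:M (- b) b^T B.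

Lemma bordered00 (R : comNzRingType) k (c : R) (b : 'rV[R]_k) (B : 'M[R]_k) :
  bordered c b B 0 0 = c.
Proof.
rewrite !mxE; case: splitP => // x _; rewrite !mxE.
by case: splitP => // y _; rewrite !mxE !ord1.
Qed.

Lemma bordered0j (R : comNzRingType) k (c : R) (b : 'rV[R]_k) (B : 'M[R]_k) j :
  bordered c b B 0 (lift 0 j) = - b 0 j.
Proof.
rewrite -rshift1 !mxE; case: splitP => // x _; by rewrite row_mxEr !mxE [x]ord1.
Qed.

Lemma borderedi0 (R : comNzRingType) k (c : R) (b : 'rV[R]_k) (B : 'M[R]_k) i :
  bordered c b B (lift 0 i) 0 = b 0 i.
Proof.
rewrite -rshift1 col_mxEd !mxE; case: splitP => // x _; by rewrite mxE [x]ord1.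
Qed.

Lemma borderedij (R : comNzRingType) k (c : R) (b : 'rV[R]_k) (B : 'M[R]_k) i j :
  bordered c b B (lift 0 i) (lift 0 j) = B i j.
Proof. by rewrite -!rshift1 block_mxEdr. Qed.

Lemma bordered_mulmx (R : comNzRingType) k (c : R) (b : 'rV[R]_k) (B C : 'M[R]_k) :
  \det (bordered c (b *m C) (C^T *m B *m C)) = \det C ^+ 2 * \det (bordered c b B).
Proof.
have -> : bordered c (b *m C) (C^T *m B *m C) =
    block_mx 1%:M 0 0 C^T *m bordered c b B *m block_mx 1%:M 0 0 C.
  rewrite /bordered !mulmx_block !(mulmx0, mul0mx, mul1mx, mulmx1, addr0, add0r).
  by rewrite mulNmx trmx_mul.
by rewrite !det_mulmx !det_ublock det_tr !det1; ring.
Qed.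

Lemma det_bordered_delta (R : comNzRingType) k (c : R) (B : 'M[R]_k.+1) :
  \det (bordered 0 (c *: delta_mx 0 0) B) = c ^+ 2 * \det (row' 0 (col' 0 B)).
Proof.
set M := bordered _ _ _.
have M0 j : M 0 (lift 0 j) = - (c *+ (j == 0)).
  by rewrite bordered0j !mxE eqxx mulr_natr.
have Mj i : M (lift 0 i) 0 = c *+ (i == 0).
  by rewrite borderedi0 !mxE eqxx mulr_natr.
have M00 : M 0 0 = 0 by rewrite bordered00.
have Mij i j : M (lift 0 i) (lift 0 j) = B i j by rewrite borderedij.
clearbody M.
rewrite (expand_det_row _ 0) big_ord_recl big_ord_recl big1 ?addr0; last first.
  by move=> j _; rewrite M0 oppr0 mul0r.
rewrite M0 eqxx mulr1n M00 mul0r add0r.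
rewrite /cofactor (expand_det_col _ 0) big_ord_recl big1 ?addr0; last first.
  move=> i _; rewrite !mxE.
  have -> : lift (lift 0 0) 0 = 0 :> 'I_(1 + k.+1) by apply: val_inj.
  by rewrite Mj mul0r.
rewrite /cofactor !mxE.
have -> : lift (lift 0 0) 0 = 0 :> 'I_(1 + k.+1) by apply: val_inj.
rewrite Mj eqxx mulr1n.
have -> : row' 0 (col' 0 (row' 0 (col' (lift 0 0) M))) = row' 0 (col' 0 B).
  apply/matrixP => i j; rewrite !mxE -Mij; congr (M _ _); apply: val_inj => //=.
by rewrite /= /bump /=; ring.
Qed.

Section SkewDet.

Variables (F : numFieldType) (n : nat).

(** Invertible column operations [C] reduce the border to a multiple of the first unit vector. The
    determinant then loses a row and a column of [B], the contraction keeps only its first term, and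
    both sides have been scaled by [\det C ^+ 2]. *)
Lemma det_bordered_sgd m (Z : 'M[F]_(n, m.+1)) (a : 'I_n -> F) :
    (forall W : 'M[F]_(n, m), \det (W^T *m Amx F n *m W) = sumdet W ^+ 2) ->
  \det (bordered 0 (\row_i a i *m Z) (Z^T *m Amx F n *m Z)) =
  (\sum_K contract a (fock Z) K) ^+ 2.
Proof.
move=> IH; set b := _ *m Z; set B := _ *m Z.
pose C := invmx (row_ebase b).
have uC : C \in unitmx by rewrite unitmx_inv row_ebase_unit.
have [c bC] : exists c, b *m C = c *: delta_mx 0 0.
  exists ((b *m C) 0 0); apply/rowP => j; rewrite -[b]mulmx_ebase /C.
  rewrite mulmxK ?row_ebase_unit // !mxE !big_ord1 !mxE.
  by case: j => [[|j] hj] /=; rewrite ?mulr1 ?mulr0.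
apply: (mulfI (x := \det C ^+ 2)).
  by rewrite expf_neq0 // -unitfE -unitmxE.
rewrite -bordered_mulmx bC det_bordered_delta -exprMn.
have -> : row' 0 (col' 0 (C^T *m B *m C)) =
          (col' 0 (Z *m C))^T *m Amx F n *m col' 0 (Z *m C).
  rewrite /B !mulmxA -trmx_mul -mulmxA; apply/matrixP => i j; rewrite !mxE.
  apply: eq_bigr => x _; rewrite !mxE; congr (_ * _).
  by apply: eq_bigr => y _; rewrite !mxE.
rewrite IH -exprMn; congr (_ ^+ 2).
have -> : \det C * \sum_K contract a (fock Z) K =
          \sum_K contract a (fock (Z *m C)) K.
  rewrite mulr_sumr; apply: eq_bigr => K _; rewrite /contract mulr_sumr.
  apply: eq_bigr => i _.
  by rewrite fock_mulmx; ring.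
have aZC j : \sum_i a i * (Z *m C) i j = c *+ (j == 0).
  have /matrixP/(_ 0 j) := bC; rewrite -mulmxA !mxE eqxx mulr_natr => <-.
  by apply: eq_bigr => i _; congr (_ * _); rewrite mxE.
rewrite sumdet_fock mulr_sumr; apply: eq_bigr => K _.
rewrite contract_fock big_ord_recl [X in _ + X]big1 ?addr0 => [|j _].
  by rewrite aZC eqxx expr0 mul1r.
by rewrite aZC mulr0 mul0r.
Qed.

(** Splitting off column 0 of [Y] presents the skew matrix as a bordered one; [det_bordered_sgd]
    then removes a second column. *)
Lemma det_sgd_double h (Y : 'M[F]_(n, h.*2)) :
  \det (Y^T *m Amx F n *m Y) = sumdet Y ^+ 2.
Proof.
elim: h Y => [|h IHh] Y.
  rewrite sumdet_fock det_mx00 (bigD1 set0) //= eqxx big1 ?addr0 ?expr1n //.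
  by move=> J /negPf->.
rewrite doubleS in Y *.
pose a (x : 'I_n) := \sum_(i < n) Y i 0 * sgd F x i.
rewrite sumdet_fock sum_fock_even ?oddS ?odd_double //.
rewrite -(@det_bordered_sgd h.*2 (col' 0 Y) a) //; congr (\det _).
apply/matrixP => i j.
have A_skew : (Y^T *m Amx F n *m Y)^T = - (Y^T *m Amx F n *m Y).
  rewrite !trmx_mul trmxK mulmxA -mulNmx -mulmxN; congr (_ *m _ *m _).
  by apply/matrixP => x y; rewrite !mxE sgd_skew.
have Aj s : (Y^T *m Amx F n *m Y) (lift 0 s) 0 = (\row_i a i *m col' 0 Y) 0 s.
  rewrite -mulmxA !mxE; apply: eq_bigr => x _; rewrite !mxE mulrC; congr (_ * _).
  by apply: eq_bigr => y _; rewrite !mxE mulrC.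
case: (unliftP 0 i) => [i'|] ->; case: (unliftP 0 j) => [j'|] ->.
- rewrite borderedij !mxE; apply: eq_bigr => x _.
  by rewrite !mxE; congr (_ * _); apply: eq_bigr => y _; rewrite !mxE.
- by rewrite Aj borderedi0.
- have /matrixP/(_ (lift 0 j') 0) := A_skew.
  by rewrite mxE => ->; rewrite mxE Aj bordered0j.
(* The corner equals its opposite, hence is zero in characteristic 0. *)
have /matrixP/(_ 0 0)/eqP := A_skew.
by rewrite mxE [X in _ == X]mxE -addr_eq0 -mulr2n mulrn_eq0 bordered00 /= => /eqP.
Qed.

Lemma det_sgd_even m (Y : 'M[F]_(n, m)) : ~~ odd m ->
  \det (Y^T *m Amx F n *m Y) = sumdet Y ^+ 2.
Proof.
move=> em; have [h mE] : exists h, m = h.*2.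
  by exists m./2; rewrite even_halfK.
by subst m; apply: det_sgd_double.
Qed.

Lemma det_bordered_odd m (Y : 'M[F]_(n, m)) : odd m ->
  \det (bordered 0 (\row_(i < n) 1 *m Y) (Y^T *m Amx F n *m Y)) = sumdet Y ^+ 2.
Proof.
case: m Y => // m Y om; rewrite det_bordered_sgd => [|W]; last exact: det_sgd_even.
by rewrite sumdet_fock sum_fock_odd.
Qed.

Lemma det_skew_odd m (M : 'M[F]_m) : odd m -> M^T = - M -> \det M = 0.
Proof.
move=> om skM; apply/eqP; rewrite -[_ == 0]orFb -(mulrn_eq0 _ 2) mulr2n.
by rewrite -{2}det_tr skM -scaleN1r detZ -signr_odd om expr1 mulN1r subrr.
Qed.

Lemma Tmx_Amx : Tmx F n = const_mx 1 + Amx F n.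
Proof. by apply/matrixP => i j; rewrite !mxE rmorphD. Qed.

(** The all-ones part of [Tmx] contributes [u^T *m u], with [u] the column sums of [Y]. The
    resulting determinant splits into two skew ones, of orders [m] and [m + 1]; the one of odd order
    vanishes. *)
Lemma det_Tmx_num m (Y : 'M[F]_(n, m)) :
  \det (Y^T *m Tmx F n *m Y) = sumdet Y ^+ 2.
Proof.
pose u : 'rV_m := \row_(i < n) 1 *m Y; pose B := Y^T *m Amx F n *m Y.
have A_skew : (Amx F n)^T = - Amx F n.
  by apply/matrixP => x y; rewrite !mxE sgd_skew.
have B_skew : B^T = - B.
  by rewrite /B !trmx_mul trmxK mulmxA A_skew mulmxN mulNmx.
have -> : Y^T *m Tmx F n *m Y = u^T *m u + B.
  rewrite Tmx_Amx mulmxDr mulmxDl; congr (_ + _).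
  rewrite /u trmx_mul !mulmxA; congr (_ *m _); rewrite -mulmxA; congr (_ *m _).
  by apply/matrixP => x y; rewrite !mxE big_ord1 !mxE mulr1.
have -> : \det (u^T *m u + B) = \det (bordered 1 u B).
  transitivity (\det (bordered 1 u B *m block_mx 1%:M u 0 1%:M)).
    rewrite /bordered mulmx_block !(mulmx0, mul0mx, mul1mx, mulmx1, addr0, add0r).
    by rewrite subrr det_lblock det1 mul1r.
  by rewrite det_mulmx det_ublock !det1 !mulr1.
(* Linearity in row 0: [(1, -u) = (0, -u) + (1, 0)]. *)
have -> : \det (bordered 1 u B) = \det (bordered 0 u B) + \det B.
  rewrite (@determinant_multilinear _ _ (bordered 1 u B) (bordered 0 u B)
    (block_mx 1%:M 0 u^T B) 0 1 1) ?det_lblock ?det1 ?mul1r //.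
  - rewrite !scale1r; apply/rowP => j; rewrite !mxE.
    case: splitP => // x _; rewrite !mxE.
    by case: splitP => y _; rewrite !mxE ?mul0rn ?add0r ?addr0.
  - apply/matrixP => x y; rewrite !mxE.
    by case: splitP => // z; rewrite [z]ord1.
  apply/matrixP => x y; rewrite !mxE.
  by case: splitP => // z; rewrite [z]ord1.
have [om|em] := boolP (odd m).
  by rewrite (@det_skew_odd _ B) // addr0 det_bordered_odd.
rewrite (@det_skew_odd _ (bordered 0 u B)) ?add0r ?[odd _]/= ?em //.
  exact: det_sgd_even.
rewrite /bordered tr_block_mx opp_block_mx B_skew trmxK linearN opprK /=.
by rewrite tr_scalar_mx raddf0 oppr0.
Qed.

End SkewDet.

(** * Minors of T *)

Section MinorsOfT.

Variable R : comNzRingType.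

(** [interlacing] for sequences of naturals, so that first terms can be split off in an
    induction. *)
Definition interlaced k (g f : 'I_k -> nat) : bool :=
  [forall r, (g r <= f r)%N] &&
  [forall r : 'I_k, forall s : 'I_k, (s == r.+1 :> nat) ==> (f r <= g s)%N].

Lemma interlaced1 (g f : 'I_1 -> nat) : interlaced g f = (g ord0 <= f ord0)%N.
Proof.
apply/andP/idP => [[/forallP + _]|gf]; first exact.
split; first by apply/forallP => r; rewrite ord1.
apply/forallP => r; apply/forallP => s; apply/implyP.
by rewrite !ord1.
Qed.

Lemma interlacedS k (g f : 'I_k.+2 -> nat) :
  interlaced g f = [&& (g ord0 <= f ord0)%N, (f ord0 <= g (lift ord0 ord0))%N
                & interlaced (g \o lift ord0) (f \o lift ord0)].
Proof.
apply/andP/and3P => [[/forallP gf /forallP fg]|[gf0 fg0 /andP[/forallP gf /forallP fg]]].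
  split; [exact: gf|by have /forallP/(_ (lift ord0 ord0))/implyP := fg ord0; apply|].
  apply/andP; split; apply/forallP => r; first exact: gf.
  apply/forallP => s; apply/implyP => /eqP sr.
  by have /forallP/(_ (lift ord0 s))/implyP := fg (lift ord0 r); apply; rewrite /= /bump /= sr.
split; apply/forallP => r.
  by case: (unliftP ord0 r) => [r' ->|-> //]; apply: gf.
apply/forallP => s; apply/implyP => /eqP.
case: (unliftP ord0 r) => [r' ->|->]; case: (unliftP ord0 s) => [s' ->|->] //=;
  rewrite /bump /= !add1n => -[sr].
  by have /forallP/(_ s')/implyP := fg r'; apply; apply/eqP.
by have -> : s' = ord0 by apply: val_inj.
Qed.

Definition missing k (f g : 'I_k -> nat) : nat := \sum_r (f r \notin codom g).

(** Later values of [f] exceed [f ord0], hence [g ord0], so dropping [g ord0] does not affect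
    them. *)
Lemma missingS k (f g : 'I_k.+1 -> nat) :
    {homo f : r s / (r < s)%N} -> (g ord0 <= f ord0)%N ->
  missing f g = ((f ord0 \notin codom g) + missing (f \o lift ord0) (g \o lift ord0))%N.
Proof.
move=> f_homo gf0; rewrite /missing big_ord_recl; congr addn.
apply: eq_bigr => r _; congr (nat_of_bool (~~ _)).
apply/codomP/codomP => [[s fs]|[s fs]]; last by exists (lift ord0 s).
case: (unliftP ord0 s) fs => [s' ->|->] fs; first by exists s'.
by have := f_homo ord0 (lift ord0 r) isT; rewrite fs ltnNge gf0.
Qed.

Definition tmx k (f g : 'I_k -> nat) : 'M[R]_k :=
  \matrix_(r, s) (1 + sgd R (f r) (g s)).

Lemma t_lt (x y : nat) : (x < y)%N -> 1 + sgd R x y = 0.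
Proof. by move=> h; rewrite sgd_lt ?ltz_nat // subrr. Qed.

Lemma t_gt (x y : nat) : (y < x)%N -> 1 + sgd R x y = 2.
Proof. by move=> h; rewrite sgd_gt ?ltz_nat. Qed.

(** Induction on [k], by the position of [f ord0] relative to the first two values of [g]. *)
Lemma det_tmx k (f g : 'I_k -> nat) :
    {homo f : r s / (r < s)%N} -> {homo g : r s / (r < s)%N} ->
  \det (tmx f g) = if interlaced g f then 2 ^+ missing f g else 0.
Proof.
elim: k f g => [|k IHk] f g f_homo g_homo.
  rewrite det_mx00 /missing big_ord0 (_ : interlaced g f) //.
  by apply/andP; split; apply/forallP => -[].
have f'_homo : {homo f \o lift ord0 : r s / (r < s)%N} by move=> r s rs; apply: f_homo.
have g'_homo : {homo g \o lift ord0 : r s / (r < s)%N} by move=> r s rs; apply: g_homo.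
have f0 r : (f ord0 < f (lift ord0 r))%N by apply: f_homo.
have g0 r : (g ord0 < g (lift ord0 r))%N by apply: g_homo.
have sub00 : row' ord0 (col' ord0 (tmx f g)) = tmx (f \o lift ord0) (g \o lift ord0).
  by apply/matrixP => r s; rewrite !mxE.
have [fg0|gf0] := ltnP (f ord0) (g ord0).
  rewrite (expand_det_row _ ord0) big1 => [|s _].
    by rewrite /interlaced; case: forallP => // /(_ ord0); rewrite leqNgt fg0.
  rewrite mxE t_lt ?mul0r //; case: (unliftP ord0 s) => [s' ->|-> //].
  exact: ltn_trans (g0 _).
(* The only nonzero entry of row 0 is then its first: [1] if [f ord0 = g ord0], else [2], which
   accounts for [f ord0] being missing from [g]. *)
have first_row : (forall s, f ord0 < g (lift ord0 s))%N ->
    \det (tmx f g) = (if interlaced (g \o lift ord0) (f \o lift ord0)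
                      then 2 ^+ missing f g else 0).
  move=> fg; rewrite (expand_det_row _ ord0) big_ord_recl big1 ?addr0 => [|s _]; last first.
    by rewrite mxE t_lt ?mul0r.
  rewrite /cofactor sub00 IHk // expr0 mul1r mxE missingS //.
  case: ifP => _; rewrite ?mulr0 // exprD; congr (_ * _).
  move: gf0; rewrite leq_eqVlt => /orP[/eqP gf|gf].
    by rewrite -gf sgdxx addr0 codom_f expr0.
  rewrite t_gt //; case: codomP => // -[s].
  case: (unliftP ord0 s) => [s' ->|->] fs; last by rewrite fs ltnn in gf.
  by have := fg s'; rewrite fs ltnn.
case: k IHk f g f_homo g_homo f'_homo g'_homo f0 g0 sub00 gf0 first_row =>
  [|k] IHk f g f_homo g_homo f'_homo g'_homo f0 g0 sub00 gf0 first_row.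
  rewrite first_row => [|[]//]; rewrite interlaced1 gf0.
  by case: ifP => // /negP[]; apply/andP; split; apply/forallP => -[].
rewrite interlacedS gf0 /=.
have [fg1|gf1|fg1] := ltngtP (f ord0) (g (lift ord0 ord0)).
- apply: first_row => s; apply: leq_trans fg1 _.
  case: (unliftP ord0 s) => [s' ->|-> //]; apply: ltnW; exact: g_homo.
(* Here columns 0 and 1 both consist of [2]s. *)
- rewrite -det_tr (determinant_alternate (i1 := ord0) (i2 := lift ord0 ord0)) // => r.
  have gr : (g (lift ord0 ord0) < f r)%N.
    by case: (unliftP ord0 r) => [r' ->|-> //]; apply: ltn_trans (f0 _).
  by rewrite !mxE !t_gt //; apply: ltn_trans gr.
have fr r : (g ord0 < f r)%N.
  case: (unliftP ord0 r) => [r' ->|->]; last by rewrite fg1.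
  by apply: leq_ltn_trans (f0 _).
(* Column 0 minus column 1 is the first unit vector. *)
rewrite missingS // fg1 codom_f add0n -IHk // -sub00.
pose N := (tmx f g)^T.
pose B := \matrix_(s, r) N (if s == ord0 then lift ord0 ord0 else s) r.
pose C := \matrix_(s, r) if s == ord0 then (r == ord0)%:R else N s r.
rewrite -det_tr -/N (@determinant_multilinear _ _ N B C ord0 1 1); first last.
- by apply/matrixP => s r; rewrite !mxE.
- by apply/matrixP => s r; rewrite !mxE.
- rewrite !scale1r; apply/rowP => r; rewrite !mxE /= t_gt //.
  case: (unliftP ord0 r) => [r' ->|->]; first by rewrite t_gt ?addr0 // -fg1.
  by rewrite fg1 sgdxx addr0.
rewrite (determinant_alternate (A := B) (i1 := ord0) (i2 := lift ord0 ord0)) // => [|r]; last first.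
  by rewrite !mxE.
rewrite mulr0 add0r mul1r (expand_det_row _ ord0) big_ord_recl big1 ?addr0 => [|r _]; last first.
  by rewrite mxE mul0r.
rewrite mxE eqxx mul1r /cofactor expr0 mul1r -det_tr; congr (\det _).
by apply/matrixP => s r; rewrite !mxE.
Qed.

Lemma minor_Tmx (n k : nat) (I J : ksubset n k) :
  minor (Tmx R n) I J = if interlacing J I then 2 ^+ pdist J I else 0.
Proof.
pose f (I : ksubset n k) (r : 'I_k) : nat := elt I r.
rewrite -[interlacing J I]/(interlaced (f J) (f I)).
have -> : pdist J I = missing (f I) (f J).
  rewrite /pdist -{1}(eqP (valP I)) setIC -cardsD -sum1_card.
  rewrite (eq_bigl (fun i => (i \in val I) && (i \notin val J))); last first.
    by move=> i; rewrite inE andbC.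
  rewrite big_mkcondr /= (big_elt _ I); apply: eq_bigr => r _.
  have -> : (f I r \in codom (f J)) = (elt I r \in val J); last by case: (_ \in _).
  apply/codomP/idP => [[s /ord_inj->]|]; first exact: mem_elt.
  by case/elt_surj=> s rs; exists s; rewrite /f rs.
rewrite -det_tmx; try exact: elt_lt.
by rewrite /minor; congr (\det _); apply/matrixP => r s; rewrite !mxE rmorphD.
Qed.

End MinorsOfT.

Lemma sum_minor_Tmx (R : comNzRingType) (n k : nat) (X : 'M[R]_n) :
  \sum_(I : ksubset n k) minor (Tmx R n *m X) I I = interlacing_sum k X.
Proof.
transitivity (\sum_(I : ksubset n k) \sum_(J : ksubset n k)
    minor (Tmx R n) I J * minor X J I).
  apply: eq_bigr => I _; rewrite /minor mxsub_mul Cauchy_Binet.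
  by apply: eq_bigr => J _; congr (_ * _); congr (\det _); apply/matrixP => r s; rewrite !mxE.
rewrite exchange_big; apply: eq_bigr => J _; rewrite [RHS]big_mkcond.
by apply: eq_bigr => I _; rewrite minor_Tmx; case: ifP; rewrite ?mul0r.
Qed.

(** * Symmetric matrices *)

Section Congruence.

Lemma map_Tmx (R S : comNzRingType) (f : {rmorphism R -> S}) n :
  map_mx f (Tmx R n) = Tmx S n.
Proof. by apply/matrixP => i j; rewrite !mxE rmorph_int. Qed.

Lemma map_sumdet (R S : comNzRingType) (f : {rmorphism R -> S}) (n k : nat)
    (Y : 'M[R]_(n, k)) :
  sumdet (map_mx f Y) = f (sumdet Y).
Proof.
by rewrite /sumdet rmorph_sum; apply: eq_bigr => I _; rewrite -map_mxsub det_map_mx.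
Qed.

Lemma map_det_Tmx (R S : comNzRingType) (f : {rmorphism R -> S}) (n k : nat)
    (Y : 'M[R]_(n, k)) :
  \det ((map_mx f Y)^T *m Tmx S n *m map_mx f Y) = f (\det (Y^T *m Tmx R n *m Y)).
Proof. by rewrite -det_map_mx !map_mxM map_trmx map_Tmx. Qed.

(** The identity holds over [rat], descends to [int] by injectivity and maps to any [R]. *)
Lemma det_Tmx_int (R : comNzRingType) (n k : nat) (V : 'M[int]_(n, k))
    (Y := map_mx intr V : 'M[R]_(n, k)) :
  \det (Y^T *m Tmx R n *m Y) = sumdet Y ^+ 2.
Proof.
rewrite /Y map_det_Tmx map_sumdet -rmorphXn; congr (_%:~R).
apply: (@intr_inj rat); rewrite rmorphXn -map_sumdet -map_det_Tmx.
exact: det_Tmx_num.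
Qed.

Variables (R : comNzRingType) (n : nat).
Implicit Types X Y : 'M[R]_n.

(** [V] is integral so that [det_Tmx_int] applies; only [d] has entries in [R]. *)
Definition int_congruence X := exists N (V : 'M[int]_(n, N)) (d : 'rV[R]_N),
  X = map_mx intr V *m diag_mx d *m (map_mx intr V)^T.

Lemma int_congruence0 : int_congruence 0.
Proof. by exists 0, 0, 0; rewrite thinmx0 mul0mx. Qed.

Lemma int_congruenceD X Y : int_congruence X -> int_congruence Y -> int_congruence (X + Y).
Proof.
move=> [N [V [d ->]]] [N' [V' [d' ->]]].
exists (N + N')%N, (row_mx V V'), (row_mx d d').
by rewrite map_row_mx diag_mx_row tr_row_mx mul_row_block !mulmx0 addr0 add0r mul_row_col.
Qed.

Lemma int_congruence_rank1 (c : R) (v : 'cV[int]_n) :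
  int_congruence (c *: (map_mx intr v *m (map_mx intr v)^T)).
Proof.
by exists 1, v, (const_mx c); rewrite diag_const_mx mul_mx_scalar scalemxAl.
Qed.

Lemma sym_int_congruence X : X^T = X -> int_congruence X.
Proof.
move=> Xsym.
pose e i : 'cV[int]_n := delta_mx i 0.
have eM i j : map_mx intr (e i) *m (map_mx intr (e j))^T = delta_mx i j :> 'M[R]_n.
  by rewrite !map_delta_mx trmx_delta mul_delta_mx.
(* Polarization without division by 2, valid over every [R]. *)
have sq i j : delta_mx i j + delta_mx j i =
    map_mx intr (e i + e j) *m (map_mx intr (e i + e j))^T
    - delta_mx i i - delta_mx j j :> 'M[R]_n.
  rewrite map_mxD linearD /= mulmxDl !mulmxDr !eM.
  by apply/matrixP => x y; rewrite !mxE; ring.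
have -> : X = \sum_(i < n) (X i i *: delta_mx i i +
    \sum_(j < n | (i < j)%N) X i j *: (delta_mx i j + delta_mx j i)).
  rewrite [LHS]matrix_sum_delta big_split /=.
  under [X in _ + X]eq_bigr => i _.
    under eq_bigr => j _ do rewrite scalerDr.
    rewrite big_split /=; over.
  rewrite big_split /= [X in _ = _ + (_ + X)](exchange_big_dep xpredT) //=.
  rewrite -!big_split; apply: eq_bigr => i _ /=.
  rewrite (bigD1 i) //=; congr (_ + _).
  rewrite (bigID (fun j : 'I_n => (i < j)%N)) /=; congr (_ + _).
    by apply: eq_bigl => j; rewrite -val_eqE /=; lia.
  apply: eq_big => [j|j _]; first by rewrite -val_eqE /=; lia.
  by rewrite -[in LHS]Xsym mxE.
apply: big_ind; [exact: int_congruence0|exact: int_congruenceD|move=> i _].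
apply: int_congruenceD.
  by rewrite -eM; apply: int_congruence_rank1.
apply: big_ind; [exact: int_congruence0|exact: int_congruenceD|move=> j _].
rewrite sq !scalerDr !scalerN -!scaleNr -!eM -addrA.
apply: int_congruenceD; first exact: int_congruence_rank1.
by apply: int_congruenceD; apply: int_congruence_rank1.
Qed.

End Congruence.

Lemma det_mxsub_diag (R : comNzRingType) (n N k : nat) (A B : 'M[R]_(n, N)) (d : 'rV_N)
    (I J : ksubset n k) :
  \det (mxsub (elt I) (elt J) (A *m diag_mx d *m B^T)) =
  \sum_(L : ksubset N k) (\prod_r d 0 (elt L r)) *
     (\det (mxsub (elt I) (elt L) A) * \det (mxsub (elt J) (elt L) B)).
Proof.
rewrite mxsub_mul Cauchy_Binet; apply: eq_bigr => L _.
rewrite mulrA; congr (_ * _); last first.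
  by rewrite -det_tr; congr (\det _); apply/matrixP => r s; rewrite !mxE.
rewrite mulrC -[X in _ * X](_ : \det (diag_mx (\row_r d 0 (elt L r))) = _); last first.
  by rewrite det_diag; apply: eq_bigr => r _; rewrite mxE.
rewrite -det_mulmx mul_mx_diag; congr (\det _).
by apply/matrixP => r s; rewrite mul_mx_diag !mxE.
Qed.

Lemma sum_minor_sym (R : comNzRingType) (n k : nat) (X : 'M[R]_n) : X^T = X ->
  \sum_(I : ksubset n k) \sum_(J : ksubset n k) minor X I J =
  \sum_(I : ksubset n k) minor (Tmx R n *m X) I I.
Proof.
move=> /sym_int_congruence[N [V [d ->]]]; set W := map_mx _ V.
(* The common value of both sides, once the diagonal entries are factored out. *)
transitivity (\sum_(L : ksubset N k) (\prod_r d 0 (elt L r)) *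
                sumdet (colsub (elt L) W) ^+ 2).
  under eq_bigr => I _ do under eq_bigr => J _ do rewrite /minor det_mxsub_diag.
  under eq_bigr => I _ do rewrite exchange_big.
  rewrite exchange_big; apply: eq_bigr => L _ /=.
  (* For fixed [L] the double sum over [I] and [J] factors into a square. *)
  rewrite expr2 /sumdet big_distrlr mulr_sumr; apply: eq_bigr => I _.
  rewrite mulr_sumr; apply: eq_bigr => J _.
  by congr (_ * (_ * _)); congr (\det _); apply/matrixP => r s; rewrite !mxE.
rewrite !mulmxA.
under [RHS]eq_bigr => I _ do rewrite /minor det_mxsub_diag.
rewrite [RHS]exchange_big; apply: eq_bigr => L _ /=.
rewrite -mulr_sumr; congr (_ * _).
(* The square becomes a determinant of a product, which Cauchy-Binet expands over [I] between the
   transposed factor and the one containing [Tmx]. *)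
rewrite /W -map_mxsub -det_Tmx_int -mulmxA Cauchy_Binet map_mxsub.
apply: eq_bigr => I _; rewrite mulrC -[X in _ * X = _]det_tr.
congr (_ * _); congr (\det _); apply/matrixP => r s; rewrite !mxE //.
by apply: eq_bigr => i _; rewrite !mxE.
Qed.

Theorem theorem2 (R : comNzRingType) (n k : nat) (X : 'M[R]_n)
    (n_ge1 : (1 <= n)%N) (k_ge1 : (1 <= k)%N) (k_le_n : (k <= n)%N)
    (X_sym : X^T = X) :
  \sum_(I : ksubset n k) minor (Tmx R n *m X) I I = interlacing_sum k X /\
  \sum_(I : ksubset n k) \sum_(J : ksubset n k) minor X I J
    = interlacing_sum k X.
Proof. by rewrite sum_minor_sym // sum_minor_Tmx. Qed.
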